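(* Let $\varepsilon>0$, $L>0$, $\widehat{\mathcal U}_0\in\mathbb R$, and let $\theta:[0,L]\to\mathbb R$ be a solution of $$\theta''+2\varepsilon\sin2\theta=0,\qquad \theta'(0)=\theta'(L)=\widehat{\mathcal U}_0,$$ such that $\theta(L-R)-\frac\pi2=-\big(\theta(R)-\frac\pi2\big)$ for all $R\in[0,L]$ and $\theta'(R)\neq0$ for all $R\in(0,L)$ (a left-handed helical equilibrium). Consider the functional $$\mathscr E[\theta]=\int_0^L\tfrac12\big(\theta'(R)-\widehat{\mathcal U}_0\big)^2+\varepsilon\cos2\theta(R)\,\mathrm dR$$ with free endpoint values. (i) If $\theta(L)\in(\pi/2,\pi)$, then $\theta$ is stable, i.e. it is a local minimum of $\mathscr E$. (ii) If $\theta(L)\in(\pi,3\pi/2)$, then $\theta$ is unstable, i.e. it is not a local minimum of $\mathscr E$.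
   Context: ''Local minimum'' is understood among all nearby $C^1$ functions on $[0,L]$ (nearness in the $C^1$ norm), with no constraint on the values $\theta(0),\theta(L)$. The given boundary value problem is the Euler–Lagrange equation of $\mathscr E$ with natural boundary conditions; $\theta(R)$ is the angle between the tangents of the two flanges of the ladder. *)

(* Defs.v *)
From Stdlib Require Import Reals Lra.
From Coquelicot Require Import Coquelicot.
Open Scope R_scope.

(* A function on [a,b] is represented by a function on R whose values outside
   [a,b] are never used: every notion below only looks at points of [a,b]. *)
Definition seg (a b : R) : R -> Prop := fun x => a <= x <= b.

(* Coquelicot's [is_derive] with [locally x] cut down to [a,b], so that the
   derivative at an endpoint is the one-sided one. *)
Definition is_derive_on (a b : R) (f : R -> R) (x l : R) : Prop :=
  filterdiff f (within (seg a b) (locally x)) (fun y : R => scal y l).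

Definition ex_derive_on (a b : R) (f : R -> R) (x : R) : Prop :=
  exists l : R, is_derive_on a b f x l.

(* Unspecified where the derivative does not exist; see [Derive_on_unique]. *)
Definition Derive_on (a b : R) (f : R -> R) (x : R) : R :=
  iota (fun l : R => is_derive_on a b f x l).

Definition C1_on (a b : R) (f : R -> R) : Prop :=
  (forall x : R, seg a b x -> ex_derive_on a b f x) /\
  continuous_on (seg a b) (Derive_on a b f).

Definition sup_norm (a b : R) (f : R -> R) : Rbar :=
  Lub_Rbar (fun y : R => exists x : R, seg a b x /\ y = Rabs (f x)).

Definition C1_norm (a b : R) (f : R -> R) : Rbar :=
  Rbar_plus (sup_norm a b f) (sup_norm a b (Derive_on a b f)).

(* No condition is imposed on the endpoint values of the competitors [eta]. *)
Definition is_local_min_C1 (a b : R) (E : (R -> R) -> R) (theta : R -> R) : Prop :=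
  exists delta : posreal,
    forall eta : R -> R,
      C1_on a b eta ->
      Rbar_lt (C1_norm a b (fun x : R => eta x - theta x)) delta ->
      E theta <= E eta.

Definition energy (eps L U0 : R) (theta : R -> R) : R :=
  RInt (fun x : R => 1 / 2 * (Derive_on 0 L theta x - U0) ^ 2
                     + eps * cos (2 * theta x)) 0 L.

Definition is_equilibrium (eps L U0 : R) (theta : R -> R) : Prop :=
  (forall x : R, seg 0 L x ->
     ex_derive_on 0 L theta x /\
     ex_derive_on 0 L (Derive_on 0 L theta) x /\
     Derive_on 0 L (Derive_on 0 L theta) x + 2 * eps * sin (2 * theta x) = 0) /\
  Derive_on 0 L theta 0 = U0 /\
  Derive_on 0 L theta L = U0.

Definition is_left_handed_helical (eps L U0 : R) (theta : R -> R) : Prop :=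
  is_equilibrium eps L U0 theta /\
  (forall x : R, seg 0 L x ->
     theta (L - x) - PI / 2 = - (theta x - PI / 2)) /\
  (forall x : R, 0 < x < L -> Derive_on 0 L theta x <> 0).

Definition stable (eps L U0 : R) (theta : R -> R) : Prop :=
  is_local_min_C1 0 L (energy eps L U0) theta.

Lemma is_derive_on_unique (a b : R) (f : R -> R) (x l1 l2 : R) :
  a < b -> seg a b x ->
  is_derive_on a b f x l1 -> is_derive_on a b f x l2 -> l1 = l2.
Proof.
intros Hab Hx [_ H1] [_ H2].
assert (Hlim : is_filter_lim (within (seg a b) (locally x)) x).
{ intros P HP. unfold within. apply filter_imp with (2 := HP). now auto. }
specialize (H1 x Hlim). specialize (H2 x Hlim).
destruct (Req_dec l1 l2) as [|Hne]; [assumption|exfalso].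
assert (He : 0 < Rabs (l1 - l2) / 4).
{ apply Rdiv_lt_0_compat; [apply Rabs_pos_lt; lra | lra]. }
generalize (filter_and _ _ (H1 (mkposreal _ He)) (H2 (mkposreal _ He))).
clear H1 H2. intros [d Hd].
assert (Hy : exists y, Rabs (y - x) < d /\ seg a b y /\ y <> x).
{ pose proof (cond_pos d) as Hd0. unfold seg in *.
  destruct (Rlt_dec x b) as [Hxb|Hxb].
  - exists (x + Rmin (d / 2) (b - x)).
    assert (0 < Rmin (d / 2) (b - x)) by (apply Rmin_glb_lt; lra).
    pose proof (Rmin_l (d / 2) (b - x)). pose proof (Rmin_r (d / 2) (b - x)).
    rewrite Rabs_pos_eq; lra.
  - exists (x - Rmin (d / 2) (x - a)).
    assert (0 < Rmin (d / 2) (x - a)) by (apply Rmin_glb_lt; lra).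
    pose proof (Rmin_l (d / 2) (x - a)). pose proof (Rmin_r (d / 2) (x - a)).
    rewrite Rabs_left; lra. }
destruct Hy as [y [Hyd [Hys Hyx]]].
destruct (Hd y Hyd Hys) as [A B].
unfold norm, minus, plus, opp, scal in A, B; simpl in A, B.
unfold abs, mult in A, B; simpl in A, B.
set (u := f y + - f x) in *. set (h := y + - x) in *.
assert (Hh : 0 < Rabs h) by (apply Rabs_pos_lt; unfold h; lra).
assert (C : Rabs ((l1 - l2) * h) <= Rabs (u + - (h * l1)) + Rabs (u + - (h * l2))).
{ replace ((l1 - l2) * h) with ((u + - (h * l2)) - (u + - (h * l1))) by ring.
  unfold Rminus at 1. eapply Rle_trans; [apply Rabs_triang|].
  rewrite Rabs_Ropp. lra. }
rewrite Rabs_mult in C.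
assert (0 < Rabs (l1 - l2) * Rabs h) by (apply Rmult_lt_0_compat; lra).
lra.
Qed.

Lemma Derive_on_unique (a b : R) (f : R -> R) (x l : R) :
  a < b -> seg a b x -> is_derive_on a b f x l -> Derive_on a b f x = l.
Proof.
intros Hab Hx Hl. unfold Derive_on.
apply (iota_unique (V := R_CompleteNormedModule) (fun l : R => is_derive_on a b f x l)).
- intros k Hk. now apply (is_derive_on_unique a b f x).
- exact Hl.
Qed.

(* Main.v *)
Require Import Defs.
From Stdlib Require Import Reals Lra Psatz.
From Coquelicot Require Import Coquelicot.
Open Scope R_scope.

(** Write [T] for the equilibrium and [P] for its derivative. The first integral
    [P ^ 2 - 2 * eps * cos (2 * T)] shows that [P] is positive up to the
    endpoints ([helical_velocity_pos]). Differentiating the equation, [P] solves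
    the Jacobi equation [P'' + 4 * eps * cos (2 * T) * P = 0], so [w = P' / P]
    solves the Riccati equation [w' + w ^ 2 + 4 * eps * cos (2 * T) = 0].

    Legendre's transformation then turns the energy difference between a
    competitor [T + h] and [T] into the boundary terms of [w * h ^ 2 / 2], the
    integral of [(h' - w * h) ^ 2 / 2] and a cubic Taylor remainder of the cosine
    ([energy_difference]). Because the end values are free, everything is
    decided by the boundary terms, whose sign is that of
    [w L = - w 0 = - 2 * eps * sin (2 * T L) / U0].

    If [PI / 2 < T L < PI], then [w L > 0]. There is room to lower [w] by
    [s * (x - L / 2)] with a small [s > 0], which produces an additional
    [s * h ^ 2 / 4] under the integral; this absorbs the cubic remainder
    ([stable_path]). If [PI < T L < 3 * PI / 2], then [w L < 0], and [h = t * P]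
    makes the square vanish identically: the difference is a negative multiple
    of [t ^ 2] up to a term of order [t ^ 3] ([unstable_path]). *)

(** * Functions on a segment, extended to the line *)

(** Precomposing with [clamp a b] makes a function constant outside [a,b]:
    continuity relative to the segment becomes continuity on the line, and the
    unrestricted calculus of derivatives applies at interior points. *)
Definition clamp (a b x : R) : R := Rmax a (Rmin x b).

Lemma clamp_in (a b x : R) : a <= b -> seg a b (clamp a b x).
Proof.
intros Hab. unfold clamp, seg. split; [apply Rmax_l|].
apply Rmax_lub; [exact Hab|apply Rmin_r].
Qed.

Lemma clamp_id (a b x : R) : seg a b x -> clamp a b x = x.
Proof.
intros [H1 H2]. unfold clamp. rewrite Rmin_left, Rmax_right; lra.
Qed.

Lemma clamp_contraction (a b x y : R) :
  Rabs (clamp a b y - clamp a b x) <= Rabs (y - x).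
Proof.
unfold clamp, Rmin. destruct (Rle_dec x b), (Rle_dec y b); unfold Rmax;
  repeat match goal with |- context [if ?d then _ else _] => destruct d end;
  unfold Rabs;
  repeat match goal with |- context [if ?d then _ else _] => destruct d end; lra.
Qed.

Lemma continuous_clamp (a b : R) (f : R -> R) (x : R) :
  a <= b -> continuous_on (seg a b) f ->
  continuous (fun y => f (clamp a b y)) x.
Proof.
intros Hab Hf P HP.
destruct (Hf (clamp a b x) (clamp_in a b x Hab) P HP) as [d Hd].
exists d. intros y Hy. apply Hd; [|apply clamp_in; exact Hab].
eapply Rle_lt_trans; [apply clamp_contraction | exact Hy].
Qed.

Lemma continuous_on_clamp (a b : R) (f : R -> R) :
  (forall x, continuous (fun y => f (clamp a b y)) x) ->
  continuous_on (seg a b) f.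
Proof.
intros Hf. apply continuous_on_ext with (fun y => f (clamp a b y)).
- intros x Hx. now rewrite clamp_id.
- apply continuous_on_forall. intros x _. apply Hf.
Qed.

Lemma locally_open_interval (a b x : R) :
  a < x < b -> locally x (fun y => a < y < b).
Proof.
intros [H1 H2]. apply filter_and.
- apply (open_gt a); exact H1.
- apply (open_lt b); exact H2.
Qed.

Lemma is_derive_clamp (a b : R) (f : R -> R) (x l : R) :
  a < x < b -> is_derive_on a b f x l ->
  is_derive (fun y => f (clamp a b y)) x l.
Proof.
intros Hx [Hl Hd].
assert (Hloc := locally_open_interval a b x Hx).
apply is_derive_ext_loc with f.
{ apply filter_imp with (2 := Hloc). intros y Hy.
  rewrite clamp_id; [reflexivity | unfold seg; lra]. }
split; [exact Hl|]. intros y Hy e.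
rewrite <- (is_filter_lim_locally_unique _ _ Hy).
assert (Hlim : is_filter_lim (within (seg a b) (locally x)) x).
{ intros P HP. apply filter_imp with (2 := HP). now auto. }
generalize (filter_and _ _ Hloc (Hd x Hlim e)). apply filter_imp.
intros z [Hz H]. apply H. unfold seg; lra.
Qed.

Lemma is_derive_on_continuous (a b : R) (f : R -> R) :
  (forall x, seg a b x -> ex_derive_on a b f x) -> continuous_on (seg a b) f.
Proof.
intros H x Hx. destruct (H x Hx) as [l Hl].
apply (filterdiff_continuous_aux (F := within (seg a b) (locally x)) f).
- eexists; exact Hl.
- intros P HP. apply filter_imp with (2 := HP). now auto.
Qed.

Lemma is_derive_on_plus (a b : R) (f g : R -> R) (x l m : R) :
  is_derive_on a b f x l -> is_derive_on a b g x m ->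
  is_derive_on a b (fun y => f y + g y) x (l + m).
Proof.
intros Hf Hg. unfold is_derive_on.
apply filterdiff_ext_lin with (1 := filterdiff_plus_fct _ _ _ _ Hf Hg).
intros y. unfold scal, plus; simpl. unfold mult; simpl. ring.
Qed.

Lemma is_derive_on_scal (a b c : R) (f : R -> R) (x l : R) :
  is_derive_on a b f x l -> is_derive_on a b (fun y => c * f y) x (c * l).
Proof.
intros Hf. unfold is_derive_on.
apply filterdiff_ext_lin with (1 := filterdiff_scal_r_fct c _ _ Rmult_comm Hf).
intros y. unfold scal; simpl. unfold mult; simpl. ring.
Qed.

Lemma is_derive_on_minus (a b : R) (f g : R -> R) (x l m : R) :
  is_derive_on a b f x l -> is_derive_on a b g x m ->
  is_derive_on a b (fun y => f y - g y) x (l - m).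
Proof.
intros Hf Hg. unfold is_derive_on.
apply filterdiff_ext_lin with (1 := filterdiff_minus_fct _ _ _ _ Hf Hg).
intros y. unfold scal, minus, plus, opp; simpl. unfold mult; simpl. ring.
Qed.

Lemma ex_derive_on_Derive_on (a b : R) (f : R -> R) (x : R) :
  a < b -> seg a b x -> ex_derive_on a b f x ->
  is_derive_on a b f x (Derive_on a b f x).
Proof.
intros Hab Hx [l Hl]. now rewrite (Derive_on_unique a b f x l Hab Hx Hl).
Qed.

Lemma Derive_on_minus (a b : R) (f g : R -> R) (x : R) :
  a < b -> seg a b x -> ex_derive_on a b f x -> ex_derive_on a b g x ->
  Derive_on a b (fun y => f y - g y) x = Derive_on a b f x - Derive_on a b g x.
Proof.
intros Hab Hx Hf Hg. apply Derive_on_unique; [exact Hab|exact Hx|].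
apply is_derive_on_minus; now apply ex_derive_on_Derive_on.
Qed.

Definition C1_path (a b : R) (f df : R -> R) : Prop :=
  (forall x, continuous f x) /\ (forall x, continuous df x) /\
  (forall x, a < x < b -> is_derive f x (df x)).

Lemma C1_path_clamp (a b : R) (f : R -> R) :
  a < b -> C1_on a b f ->
  C1_path a b (fun x => f (clamp a b x)) (fun x => Derive_on a b f (clamp a b x)).
Proof.
intros Hab [Hd Hc]. split; [|split].
- intros x. apply continuous_clamp; [lra|]. now apply is_derive_on_continuous.
- intros x. apply continuous_clamp; [lra|exact Hc].
- intros x Hx. assert (Hs : seg a b x) by (unfold seg; lra).
  rewrite (clamp_id a b x Hs). apply is_derive_clamp; [exact Hx|].
  apply ex_derive_on_Derive_on; auto.
Qed.

(** * The $C^1$ norm *)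

Lemma sup_norm_ub (a b : R) (f : R -> R) (x : R) :
  seg a b x -> Rbar_le (Rabs (f x)) (sup_norm a b f).
Proof.
intros Hx. apply (proj1 (Lub_Rbar_correct _)). now exists x.
Qed.

Lemma sup_norm_le (a b : R) (f : R -> R) (M : R) :
  (forall x, seg a b x -> Rabs (f x) <= M) -> Rbar_le (sup_norm a b f) M.
Proof.
intros H. apply (proj2 (Lub_Rbar_correct _)).
intros y [x [Hx ->]]. now apply H.
Qed.

Lemma C1_norm_lt_ub (a b d : R) (f : R -> R) (x : R) :
  a <= b -> seg a b x -> Rbar_lt (C1_norm a b f) d -> Rabs (f x) < d.
Proof.
intros Hab Hx. unfold C1_norm.
pose proof (sup_norm_ub a b f x Hx) as H1.
pose proof (sup_norm_ub a b (Derive_on a b f) x Hx) as H2.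
pose proof (Rabs_pos (Derive_on a b f x)) as H3.
destruct (sup_norm a b f) as [s| |], (sup_norm a b (Derive_on a b f)) as [t| |];
  simpl in *; try tauto; intros; lra.
Qed.

Lemma C1_norm_le (a b M N : R) (f : R -> R) :
  (forall x, seg a b x -> Rabs (f x) <= M) ->
  (forall x, seg a b x -> Rabs (Derive_on a b f x) <= N) ->
  Rbar_le (C1_norm a b f) (M + N).
Proof.
intros H1 H2. unfold C1_norm.
apply sup_norm_le in H1. apply sup_norm_le in H2.
destruct (sup_norm a b f) as [s| |], (sup_norm a b (Derive_on a b f)) as [t| |];
  simpl in *; try tauto; lra.
Qed.

(** * Monotonicity from the sign of the derivative *)

Lemma is_derive_nonneg_le (a b : R) (f df : R -> R) :
  a <= b -> (forall x, continuous f x) ->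
  (forall x, a < x < b -> is_derive f x (df x)) ->
  (forall x, a < x < b -> 0 <= df x) -> f a <= f b.
Proof.
intros Hab Hc Hd Hpos.
(* The mean value point may be an endpoint, where nothing is known about
   [df]; the value 0 there serves the purpose. *)
set (g := fun x => if Rlt_dec a x then if Rlt_dec x b then df x else 0 else 0).
destruct (MVT_gen f a b g) as [c [_ Hfc]].
- rewrite Rmin_left, Rmax_right by lra. intros x Hx. unfold g.
  destruct (Rlt_dec a x); [|lra]. destruct (Rlt_dec x b); [|lra]. now apply Hd.
- intros x _. apply continuity_pt_filterlim, Hc.
- assert (0 <= g c).
  { unfold g. destruct (Rlt_dec a c); [|lra]. destruct (Rlt_dec c b); [|lra].
    apply Hpos; lra. }
  assert (0 <= g c * (b - a)) by (apply Rmult_le_pos; lra). lra.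
Qed.

Lemma is_derive_zero_eq (a b : R) (f : R -> R) :
  a <= b -> (forall x, continuous f x) ->
  (forall x, a < x < b -> is_derive f x 0) -> f a = f b.
Proof.
intros Hab Hc Hd. apply Rle_antisym.
- apply (is_derive_nonneg_le a b f (fun _ => 0)); auto. intros; lra.
- apply Ropp_le_cancel.
  apply (is_derive_nonneg_le a b (fun x => - f x) (fun _ => 0)); auto.
  + intros x. apply (continuous_opp (V := R_NormedModule) f), Hc.
  + intros x Hx. evar_last.
    * apply (is_derive_opp (V := R_NormedModule) f), Hd, Hx.
    * apply Ropp_0.
  + intros; lra.
Qed.

(** The derivative is only required inside the segment, so that [G] may be
    built from functions differentiable there and merely continuous up to the
    endpoints. *)
Lemma RInt_derive_interior (a b : R) (f G : R -> R) :
  a <= b -> (forall x, continuous f x) -> (forall x, continuous G x) ->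
  (forall x, a < x < b -> is_derive G x (f x)) ->
  RInt f a b = G b - G a.
Proof.
intros Hab Hf HG Hd.
assert (HF : forall x, is_derive (fun y => RInt f a y) x (f x)).
{ intros x. apply (is_derive_RInt f (fun y => RInt f a y) a x); [|apply Hf].
  apply filter_forall. intros y. apply (RInt_correct (V := R_CompleteNormedModule)).
  apply (ex_RInt_continuous (V := R_CompleteNormedModule)). intros; apply Hf. }
assert (H : RInt f a a - G a = RInt f a b - G b).
{ apply (is_derive_zero_eq a b (fun x => RInt f a x - G x)).
  - exact Hab.
  - intros x.
    apply (continuous_minus (V := R_NormedModule) (fun y => RInt f a y) G);
      [|apply HG].
    apply (ex_derive_continuous (V := R_NormedModule) (fun y => RInt f a y)).
    eexists; apply HF.
  - intros x Hx. replace 0 with (f x - f x) by ring.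
    apply (is_derive_minus (V := R_NormedModule) (fun y => RInt f a y) G);
      [apply HF | now apply Hd]. }
rewrite RInt_point in H. unfold zero in H; simpl in H. lra.
Qed.

Lemma RInt_minus_continuous (a b : R) (f g : R -> R) :
  (forall x, continuous f x) -> (forall x, continuous g x) ->
  RInt (fun x => f x - g x) a b = RInt f a b - RInt g a b.
Proof.
intros Hf Hg. apply (RInt_minus (V := R_CompleteNormedModule) f g);
  apply (ex_RInt_continuous (V := R_CompleteNormedModule)); intros; auto.
Qed.

(** * Third-order Taylor remainder of the cosine *)

Lemma derive_bound_pow (n : nat) (f g : R -> R) (u : R) :
  f 0 = 0 -> (forall v, is_derive f v (g v)) ->
  (forall v, Rabs (g v) <= Rabs v ^ n) -> Rabs (f u) <= Rabs u ^ S n.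
Proof.
intros H0 Hd Hb.
destruct (MVT_gen f 0 u g) as [c [Hc Hfc]].
- intros; apply Hd.
- intros x _. apply continuity_pt_filterlim.
  apply (ex_derive_continuous (V := R_NormedModule) f). eexists; apply Hd.
- rewrite H0, !Rminus_0_r in Hfc. rewrite Hfc, Rabs_mult, Rmult_comm. simpl.
  apply Rmult_le_compat_l; [apply Rabs_pos|].
  eapply Rle_trans; [apply Hb|]. apply pow_incr. split; [apply Rabs_pos|].
  revert Hc. unfold Rmin, Rmax, Rabs.
  repeat match goal with |- context [if ?d then _ else _] => destruct d end; lra.
Qed.

Definition cos_rem (a u : R) : R :=
  cos (a + u) - (cos a - sin a * u - cos a * u ^ 2 / 2).

Lemma cos_rem_bound (a u : R) : Rabs (cos_rem a u) <= Rabs u ^ 3.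
Proof.
apply (derive_bound_pow 2 (cos_rem a)
         (fun v => - sin (a + v) + sin a + cos a * v)).
- unfold cos_rem. rewrite Rplus_0_r. field.
- intros v. unfold cos_rem. auto_derive; [trivial|]. field.
- clear u; intros u.
  apply (derive_bound_pow 1 (fun v => - sin (a + v) + sin a + cos a * v)
           (fun v => - cos (a + v) + cos a)).
  + rewrite Rplus_0_r. ring.
  + intros v. auto_derive; [trivial|]. ring.
  + clear u; intros u. apply (derive_bound_pow 0 (fun v => - cos (a + v) + cos a) (fun v => sin (a + v))).
    * rewrite Rplus_0_r. ring.
    * intros v. auto_derive; [trivial|]. ring.
    * intros v. simpl. apply Rabs_le. destruct (SIN_bound (a + v)); lra.
Qed.

(** * Comparing the energies of two curves *)

Definition density (eps U0 t p : R) : R :=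
  1 / 2 * (p - U0) ^ 2 + eps * cos (2 * t).

Ltac solve_continuous :=
  repeat match goal with
    | H : forall x, continuous ?f x |- continuous ?f _ => apply H
    | H : forall x, continuous ?f x |- continuous (fun y => ?f y) _ => apply H
    | H : continuous ?f ?x |- continuous ?f ?x => exact H
    | H : continuous ?f ?x |- continuous (fun y => ?f y) ?x => exact H
    | |- continuous (fun _ => ?c) _ => apply continuous_const
    | |- continuous (fun y => y) _ => apply continuous_id
    | |- continuous (fun y => @?f y + @?g y) _ =>
        apply (continuous_plus (V := R_NormedModule) f g)
    | |- continuous (fun y => @?f y - @?g y) _ =>
        apply (continuous_minus (V := R_NormedModule) f g)
    | |- continuous (fun y => - @?f y) _ =>
        apply (continuous_opp (V := R_NormedModule) f)
    | |- continuous (fun y => @?f y * @?g y) _ =>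
        apply (continuous_mult (K := R_AbsRing) f g)
    | |- continuous (fun y => cos (@?f y)) _ => apply (continuous_cos_comp f)
    | |- continuous (fun y => sin (@?f y)) _ => apply (continuous_sin_comp f)
    end.

Lemma continuous_density (eps U0 : R) (T P : R -> R) (x : R) :
  continuous T x -> continuous P x ->
  continuous (fun y => density eps U0 (T y) (P y)) x.
Proof.
intros HT HP. unfold density. simpl. solve_continuous.
Qed.

Lemma energy_clamp (eps L U0 : R) (f : R -> R) :
  0 < L ->
  energy eps L U0 f =
  RInt (fun x => density eps U0 (f (clamp 0 L x)) (Derive_on 0 L f (clamp 0 L x))) 0 L.
Proof.
intros HL. unfold energy. apply RInt_ext.
rewrite Rmin_left, Rmax_right by lra. intros x Hx.
rewrite clamp_id by (unfold seg; lra). reflexivity.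
Qed.

(** [equilibrium_path] is the equation of a pendulum with angle [T] and
    angular velocity [P], with the natural boundary conditions. *)
Definition equilibrium_path (eps L U0 : R) (T P : R -> R) : Prop :=
  C1_path 0 L T P /\
  (forall x, 0 < x < L -> is_derive P x (- 2 * eps * sin (2 * T x))) /\
  P 0 = U0 /\ P L = U0.

(** What is left of the energy difference after the exact derivative of
    [(P - U0) * h + w * h ^ 2 / 2] has been subtracted, where [h] and [k] are
    the perturbations of angle and velocity and [r] measures the failure of [w]
    to solve the Riccati equation. *)
Definition excess (eps t h k w r : R) : R :=
  (k - w * h) ^ 2 / 2 - r * h ^ 2 / 2 + eps * cos_rem (2 * t) (2 * h).

Lemma continuous_excess (eps : R) (T P Y Q w r : R -> R) (x : R) :
  (forall x, continuous T x) -> (forall x, continuous P x) ->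
  (forall x, continuous Y x) -> (forall x, continuous Q x) ->
  (forall x, continuous w x) -> (forall x, continuous r x) ->
  continuous (fun y => excess eps (T y) (Y y - T y) (Q y - P y) (w y) (r y)) x.
Proof.
intros HT HP HY HQ Hw Hr. unfold excess, cos_rem, Rdiv. simpl. solve_continuous.
Qed.

(** Legendre's transformation. The terms linear in the perturbation integrate to
    zero by the equation and the natural boundary conditions. *)
Lemma energy_difference (eps L U0 : R) (T P Y Q w r : R -> R) :
  0 < L -> equilibrium_path eps L U0 T P -> C1_path 0 L Y Q ->
  (forall x, continuous w x) -> (forall x, continuous r x) ->
  (forall x, 0 < x < L ->
     is_derive w x (r x - w x ^ 2 - 4 * eps * cos (2 * T x))) ->
  RInt (fun x => density eps U0 (Y x) (Q x)) 0 L -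
  RInt (fun x => density eps U0 (T x) (P x)) 0 L =
  w L * (Y L - T L) ^ 2 / 2 - w 0 * (Y 0 - T 0) ^ 2 / 2 +
  RInt (fun x => excess eps (T x) (Y x - T x) (Q x - P x) (w x) (r x)) 0 L.
Proof.
intros HL [[HT [HP HTd]] [HPd [HP0 HPL]]] [HY [HQ HYd]] Hw Hr Hwd.
set (e := fun x => excess eps (T x) (Y x - T x) (Q x - P x) (w x) (r x)).
assert (He : forall x, continuous e x)
  by (intros x; now apply continuous_excess).
assert (HcY := fun x => continuous_density eps U0 Y Q x (HY x) (HQ x)).
assert (HcT := fun x => continuous_density eps U0 T P x (HT x) (HP x)).
set (dY := fun x => density eps U0 (Y x) (Q x)) in *.
set (dT := fun x => density eps U0 (T x) (P x)) in *.
assert (Hc : forall x, continuous (fun y => dY y - dT y) x)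
  by (intros x; solve_continuous).
assert (E := RInt_derive_interior 0 L (fun x => dY x - dT x - e x) (fun x =>
  (P x - U0) * (Y x - T x) + w x * (Y x - T x) ^ 2 / 2)).
rewrite (RInt_minus_continuous 0 L (fun x => dY x - dT x) e Hc He),
  (RInt_minus_continuous 0 L dY dT HcY HcT), HP0, HPL in E.
enough (RInt dY 0 L - RInt dT 0 L - RInt e 0 L =
  (U0 - U0) * (Y L - T L) + w L * (Y L - T L) ^ 2 / 2 -
  ((U0 - U0) * (Y 0 - T 0) + w 0 * (Y 0 - T 0) ^ 2 / 2)) by lra.
apply E; clear E.
- lra.
- intros x. solve_continuous.
- intros x. unfold Rdiv. simpl. solve_continuous.
- intros x Hx.
  auto_derive.
  + repeat split; eexists; eauto.
  + rewrite (is_derive_unique (fun y : R => P y) _ _ (HPd x Hx)), (is_derive_unique (fun y : R => T y) _ _ (HTd x Hx)),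
      (is_derive_unique (fun y : R => Y y) _ _ (HYd x Hx)), (is_derive_unique (fun y : R => w y) _ _ (Hwd x Hx)).
    unfold dY, dT, e, excess, density, cos_rem.
    replace (2 * T x + 2 * (Y x - T x)) with (2 * Y x) by ring. field.
Qed.

(** * Equilibria *)

Lemma equilibrium_C1_on (eps L U0 : R) (theta : R -> R) :
  is_equilibrium eps L U0 theta -> C1_on 0 L theta.
Proof.
intros [H _]. split.
- intros x Hx. apply (H x Hx).
- apply is_derive_on_continuous. intros x Hx. apply (H x Hx).
Qed.

Lemma equilibrium_Derive_on (eps L U0 : R) (theta : R -> R) (x : R) :
  0 < L -> is_equilibrium eps L U0 theta -> seg 0 L x ->
  is_derive_on 0 L (Derive_on 0 L theta) x (- 2 * eps * sin (2 * theta x)).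
Proof.
intros HL [H _] Hx. destruct (H x Hx) as [_ [H2 H3]].
apply (ex_derive_on_Derive_on 0 L _ x HL Hx) in H2.
replace (- 2 * eps * sin (2 * theta x))
  with (Derive_on 0 L (Derive_on 0 L theta) x) by lra.
exact H2.
Qed.

Lemma equilibrium_path_clamp (eps L U0 : R) (theta : R -> R) :
  0 < L -> is_equilibrium eps L U0 theta ->
  equilibrium_path eps L U0 (fun x => theta (clamp 0 L x))
    (fun x => Derive_on 0 L theta (clamp 0 L x)).
Proof.
intros HL H. split; [|split; [|split]].
- apply C1_path_clamp; [exact HL|]. now apply equilibrium_C1_on in H.
- intros x Hx. assert (Hs : seg 0 L x) by (unfold seg; lra).
  rewrite (clamp_id 0 L x Hs).
  apply is_derive_clamp; [exact Hx|]. now apply (equilibrium_Derive_on eps L U0).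
- rewrite clamp_id by (unfold seg; lra). apply H.
- rewrite clamp_id by (unfold seg; lra). apply H.
Qed.

Lemma equilibrium_first_integral (eps L U0 : R) (T P : R -> R) (x : R) :
  equilibrium_path eps L U0 T P -> seg 0 L x ->
  P x ^ 2 - 2 * eps * cos (2 * T x) = U0 ^ 2 - 2 * eps * cos (2 * T L).
Proof.
intros [[HT [HP HTd]] [HPd [HP0 HPL]]] [Hx0 HxL].
rewrite <- HPL.
apply (is_derive_zero_eq x L (fun y => P y ^ 2 - 2 * eps * cos (2 * T y))).
- exact HxL.
- intros y. simpl. solve_continuous.
- intros y Hy. assert (Hy' : 0 < y < L) by lra.
  auto_derive.
  + repeat split; eexists; eauto.
  + rewrite (is_derive_unique (fun y : R => P y) _ _ (HPd y Hy')), (is_derive_unique (fun y : R => T y) _ _ (HTd y Hy')).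
    ring.
Qed.

Lemma equilibrium_velocity_bound (eps L U0 : R) (T P : R -> R) (x : R) :
  0 < eps -> equilibrium_path eps L U0 T P -> seg 0 L x ->
  Rabs (P x) <= U0 ^ 2 + 4 * eps + 1.
Proof.
intros Heps H Hx.
pose proof (equilibrium_first_integral eps L U0 T P x H Hx) as E.
destruct (COS_bound (2 * T x)), (COS_bound (2 * T L)).
assert (Hsq : P x ^ 2 <= U0 ^ 2 + 4 * eps) by nra.
apply Rabs_le. nra.
Qed.

(** By the first integral, [U0 ^ 2 >= P (L / 2) ^ 2], since
    [cos (2 * T)] takes its least value [-1] at the middle of the curve. So the velocity vanishes nowhere, not
    even at the ends, and its sign is that of [T L - T 0]. *)
Lemma helical_velocity_pos (eps L U0 : R) (T P : R -> R) (x : R) :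
  0 < eps -> 0 < L -> equilibrium_path eps L U0 T P ->
  T (L / 2) = PI / 2 -> (forall y, 0 < y < L -> P y <> 0) -> T 0 < T L ->
  seg 0 L x -> 0 < P x.
Proof.
intros Heps HL H Hmid Hne Hinc Hx.
assert (Hhalf : 0 < L / 2 < L) by lra.
assert (HU : U0 <> 0).
{ intros HU.
  pose proof (equilibrium_first_integral eps L U0 T P (L / 2) H
                ltac:(unfold seg; lra)) as E.
  rewrite Hmid in E. replace (2 * (PI / 2)) with PI in E by field.
  rewrite cos_PI, HU in E. destruct (COS_bound (2 * T L)).
  pose proof (pow2_gt_0 (P (L / 2)) (Hne _ Hhalf)). nra. }
destruct H as [[HT [HP HTd]] [HPd [HP0 HPL]]].
assert (Hne' : forall y, seg 0 L y -> P y <> 0).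
{ intros y [[Hy0|Hy0] [HyL|HyL]].
  - apply Hne; lra.
  - now rewrite HyL, HPL.
  - now rewrite <- Hy0, HP0.
  - now rewrite HyL, HPL. }
assert (HIVT : forall y z, seg 0 L y -> seg 0 L z -> P y < 0 -> 0 < P z -> False).
{ intros y z Hy Hz Hyneg Hzpos.
  destruct (IVT_gen P y z 0) as [c [Hc Hc0]].
  - intros u. apply continuity_pt_filterlim, HP.
  - rewrite Rmin_left, Rmax_right; lra.
  - apply (Hne' c); [|exact Hc0]. unfold seg in *.
    revert Hc. unfold Rmin, Rmax. destruct (Rle_dec y z); lra. }
destruct (Rtotal_order (P x) 0) as [Hneg|[Hz|Hpos]];
  [exfalso | now apply Hne' in Hz | exact Hpos].
assert (- T 0 <= - T L).
{ apply (is_derive_nonneg_le 0 L (fun y => - T y) (fun y => - P y)).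
  - lra.
  - intros y. solve_continuous.
  - intros y Hy. apply (is_derive_opp (V := R_NormedModule) T), HTd, Hy.
  - intros y Hy. destruct (Rle_lt_dec (P y) 0) as [|Hy']; [lra|].
    exfalso. apply (HIVT x y); auto. unfold seg; lra. }
lra.
Qed.

(** The velocity solves the linearized equation, so its logarithmic derivative
    solves the Riccati equation. *)
Lemma is_derive_log_velocity (eps L U0 : R) (T P : R -> R) (x : R) :
  equilibrium_path eps L U0 T P -> 0 < x < L -> P x <> 0 ->
  is_derive (fun y => - 2 * eps * sin (2 * T y) / P y) x
    (- (- 2 * eps * sin (2 * T x) / P x) ^ 2 - 4 * eps * cos (2 * T x)).
Proof.
intros [[HT [HP HTd]] [HPd _]] Hx Hne.
auto_derive.
- repeat split; try (eexists; eauto). exact Hne.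
- rewrite (is_derive_unique (fun y : R => P y) _ _ (HPd x Hx)), (is_derive_unique (fun y : R => T y) _ _ (HTd x Hx)).
  field. exact Hne.
Qed.

Lemma continuous_log_velocity (eps : R) (T P : R -> R) (x : R) :
  continuous T x -> continuous P x -> P x <> 0 ->
  continuous (fun y => - 2 * eps * sin (2 * T y) / P y) x.
Proof.
intros HT HP Hne. unfold Rdiv.
apply (continuous_mult (K := R_AbsRing)).
- solve_continuous.
- now apply continuous_Rinv_comp.
Qed.

(** * Stability *)

Lemma sin_2_PI_minus (x : R) : sin (2 * (PI - x)) = - sin (2 * x).
Proof.
replace (2 * (PI - x)) with (2 * PI - 2 * x) by ring.
rewrite sin_minus, sin_2PI, cos_2PI. ring.
Qed.

Lemma helical_increasing (L : R) (T P : R -> R) (x y : R) :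
  C1_path 0 L T P -> (forall z, 0 < P z) -> 0 <= x <= y -> y <= L -> T x <= T y.
Proof.
intros [HT [_ HTd]] HP Hxy HyL.
apply (is_derive_nonneg_le x y T P); [lra|exact HT| |].
- intros z Hz. apply HTd; lra.
- intros z _. apply Rlt_le, HP.
Qed.

(** Below angle [PI] the logarithmic derivative of the velocity has the sign of
    [x - L / 2]. Lowering it by a small multiple of [x - L / 2] makes the
    Riccati inequality strict and keeps the boundary terms nonnegative. *)
Lemma stable_path (eps L U0 : R) (T P : R -> R) :
  0 < eps -> 0 < L -> equilibrium_path eps L U0 T P ->
  (forall x, 0 < P x) -> T (L / 2) = PI / 2 -> T 0 = PI - T L ->
  PI / 2 < T L < PI ->
  exists d, 0 < d /\ forall Y Q,
    C1_path 0 L Y Q ->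
    (forall x, seg 0 L x -> Rabs (Y x - T x) < d) ->
    RInt (fun x => density eps U0 (T x) (P x)) 0 L <=
    RInt (fun x => density eps U0 (Y x) (Q x)) 0 L.
Proof.
intros Heps HL Heq Hpos Hmid Hsym HTL.
assert (HTP := proj1 Heq).
assert (Heq' := Heq). destruct Heq' as [[HT [HP _]] [_ [HP0 HPL]]].
assert (HU : 0 < U0) by (rewrite <- HPL; apply Hpos).
set (w0 := fun x => - 2 * eps * sin (2 * T x) / P x).
assert (Hw0 : forall x, continuous w0 x).
{ intros x. apply continuous_log_velocity; auto. apply Rgt_not_eq, Hpos. }
assert (Hw0L : 0 < w0 L).
{ unfold w0. assert (sin (2 * T L) < 0) by (apply sin_lt_0; lra).
  apply Rdiv_lt_0_compat; [nra | apply Hpos]. }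
assert (Hw00 : w0 0 = - w0 L).
{ unfold w0. rewrite Hsym, HP0, HPL, sin_2_PI_minus. field. lra. }
assert (Hsign : forall x, 0 < x < L -> 0 <= w0 x * (x - L / 2)).
{ intros x Hx. unfold w0.
  assert (Hs : sin (2 * T x) * (x - L / 2) <= 0).
  { destruct (Rle_dec x (L / 2)) as [Hle|Hgt].
    - assert (T 0 <= T x) by (apply (helical_increasing L T P); auto; lra).
      assert (T x <= T (L / 2)) by (apply (helical_increasing L T P); auto; lra).
      assert (0 <= sin (2 * T x)) by (apply sin_ge_0; lra). nra.
    - assert (T (L / 2) <= T x) by (apply (helical_increasing L T P); auto; lra).
      assert (T x <= T L) by (apply (helical_increasing L T P); auto; lra).
      assert (sin (2 * T x) <= 0) by (apply sin_le_0; lra). nra. }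
  replace (- 2 * eps * sin (2 * T x) / P x * (x - L / 2))
    with (2 * eps * (- (sin (2 * T x) * (x - L / 2))) * / P x)
    by (field; apply Rgt_not_eq, Hpos).
  apply Rmult_le_pos; [nra | apply Rlt_le, Rinv_0_lt_compat, Hpos]. }
(* The first bound gives [s ^ 2 * (x - L / 2) ^ 2 <= s / 2]; the second keeps
   the lowered function nonnegative at [L]. *)
set (s := Rmin (2 / L ^ 2) (2 * w0 L / L)).
assert (HL2 : 0 < L ^ 2) by nra.
assert (Hs : 0 < s).
{ unfold s. apply Rmin_glb_lt; apply Rdiv_lt_0_compat; lra. }
assert (Hs1 : s * L ^ 2 <= 2).
{ apply Rmult_le_reg_r with (/ L ^ 2); [now apply Rinv_0_lt_compat|].
  rewrite Rmult_assoc, Rinv_r, Rmult_1_r by lra. apply Rmin_l. }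
assert (Hs2 : s * L <= 2 * w0 L).
{ apply Rmult_le_reg_r with (/ L); [now apply Rinv_0_lt_compat|].
  rewrite Rmult_assoc, Rinv_r, Rmult_1_r by lra. apply Rmin_r. }
set (w := fun x => w0 x - s * (x - L / 2)).
set (r := fun x => - s - 2 * s * w0 x * (x - L / 2) + s * s * ((x - L / 2) * (x - L / 2))).
assert (Hw : forall x, continuous w x).
{ intros x. unfold w. solve_continuous. }
assert (Hr : forall x, continuous r x).
{ intros x. unfold r. solve_continuous. }
(* For [Rabs h < s / (32 * eps)] the remainder, at most
   [8 * eps * Rabs h ^ 3], is dominated by [s * h ^ 2 / 4]. *)
exists (s / (32 * eps)). split; [apply Rdiv_lt_0_compat; lra|].
intros Y Q HYQ Hclose.
apply Rminus_le_0.
rewrite (energy_difference eps L U0 T P Y Q w r HL Heq HYQ Hw Hr).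
- assert (HwL : 0 <= w L) by (unfold w; lra).
  assert (Hw0' : w 0 <= 0) by (unfold w; lra).
  assert (0 <= RInt (fun x => excess eps (T x) (Y x - T x) (Q x - P x) (w x) (r x)) 0 L).
  { apply RInt_ge_0; [lra| |].
    - apply (ex_RInt_continuous (V := R_CompleteNormedModule)). intros x _.
      destruct HYQ as [HY [HQ _]]. now apply continuous_excess.
    - intros x Hx.
      assert (Hh := Hclose x ltac:(unfold seg; lra)).
      set (h := Y x - T x) in *. unfold excess.
      assert (Hrx : r x <= - s / 2).
      { specialize (Hsign x Hx). unfold r.
        assert ((x - L / 2) * (x - L / 2) <= L ^ 2 / 4) by nra.
        assert (s * s * ((x - L / 2) * (x - L / 2)) <= s * s * (L ^ 2 / 4))
          by (apply Rmult_le_compat_l; nra).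
        nra. }
      assert (Hrem : - (8 * (Rabs h * h ^ 2)) <= cos_rem (2 * T x) (2 * h)).
      { pose proof (cos_rem_bound (2 * T x) (2 * h)) as B.
        rewrite Rabs_mult, (Rabs_pos_eq 2) in B by lra.
        apply Rabs_le_between in B.
        replace (8 * (Rabs h * h ^ 2)) with ((2 * Rabs h) ^ 3); [lra|].
        rewrite <- (pow2_abs h). ring. }
      assert (Hsmall : eps * (8 * Rabs h) <= s / 4).
      { apply Rlt_le in Hh. apply (Rmult_le_compat_l (8 * eps)) in Hh; [|lra].
        replace (8 * eps * (s / (32 * eps))) with (s / 4) in Hh by (field; lra).
        lra. }
      pose proof (pow2_ge_0 h). pose proof (pow2_ge_0 (Q x - P x - w x * h)).
      apply (Rmult_le_compat_l eps) in Hrem; [|lra].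
      assert (eps * (8 * Rabs h) * h ^ 2 <= s / 4 * h ^ 2)
        by (now apply Rmult_le_compat_r).
      assert (r x * h ^ 2 <= - s / 2 * h ^ 2) by (now apply Rmult_le_compat_r).
      lra. }
  pose proof (Rmult_le_pos _ _ HwL (pow2_ge_0 (Y L - T L))).
  pose proof (Rmult_le_pos (- w 0) _ ltac:(lra) (pow2_ge_0 (Y 0 - T 0))).
  lra.
- intros x Hx.
  pose proof (is_derive_log_velocity eps L U0 T P x Heq Hx
                (Rgt_not_eq _ _ (Hpos x))) as Hd.
  fold (w0 x) in Hd. change (is_derive w0 x (- w0 x ^ 2 - 4 * eps * cos (2 * T x))) in Hd.
  unfold w at 1. auto_derive.
  + repeat split. eexists; exact Hd.
  + rewrite (is_derive_unique (fun y : R => w0 y) _ _ Hd). unfold r, w. ring.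
Qed.

(** * Instability *)

(** Translating the curve along itself, to first order, is the direction
    [t * P]: the quadratic form is then reduced to its boundary term, which is
    negative beyond angle [PI]. *)
Lemma unstable_path (eps L U0 : R) (T P : R -> R) :
  0 < eps -> 0 < L -> equilibrium_path eps L U0 T P ->
  (forall x, 0 < P x) -> T 0 = PI - T L -> 0 < sin (2 * T L) ->
  exists d, 0 < d /\ forall t Y Q,
    0 < t < d -> C1_path 0 L Y Q ->
    (forall x, Y x = T x + t * P x) ->
    (forall x, Q x = P x + t * (- 2 * eps * sin (2 * T x))) ->
    RInt (fun x => density eps U0 (Y x) (Q x)) 0 L <
    RInt (fun x => density eps U0 (T x) (P x)) 0 L.
Proof.
intros Heps HL Heq Hpos Hsym Hsin.
assert (Heq' := Heq). destruct Heq' as [[HT [HP _]] [_ [HP0 HPL]]].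
assert (HU : 0 < U0) by (rewrite <- HPL; apply Hpos).
set (M := U0 ^ 2 + 4 * eps + 1).
assert (HM : 0 < M) by (unfold M; nra).
assert (HM3 : 0 < M ^ 3) by (now apply pow_lt).
(* The boundary terms are [- 2 * eps * t ^ 2 * U0 * sin (2 * T L)] and the
   remainder integrates to at most [8 * eps * t ^ 3 * M ^ 3 * L]. *)
exists (U0 * sin (2 * T L) / (4 * M ^ 3 * L)).
split; [apply Rdiv_lt_0_compat; apply Rmult_lt_0_compat; lra|].
intros t Y Q Ht HYQ HY HQ.
set (w := fun x => - 2 * eps * sin (2 * T x) / P x).
assert (Hw : forall x, continuous w x).
{ intros x. apply continuous_log_velocity; auto. apply Rgt_not_eq, Hpos. }
apply Rminus_lt_0. rewrite <- Ropp_minus_distr. apply Ropp_0_gt_lt_contravar.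
rewrite (energy_difference eps L U0 T P Y Q w (fun _ => 0) HL Heq HYQ Hw
           (fun x => continuous_const 0 x)).
- assert (HI : RInt (fun x => excess eps (T x) (Y x - T x) (Q x - P x) (w x) 0) 0 L
               <= eps * (8 * (t ^ 3 * M ^ 3)) * L).
  { replace (eps * (8 * (t ^ 3 * M ^ 3)) * L)
      with (RInt (fun _ => eps * (8 * (t ^ 3 * M ^ 3))) 0 L)
      by (rewrite RInt_const; unfold scal; simpl; unfold mult; simpl; ring).
    apply RInt_le; [lra| | |].
    - apply (ex_RInt_continuous (V := R_CompleteNormedModule)). intros x _.
      destruct HYQ as [HYc [HQc _]].
      apply (continuous_excess eps T P Y Q w (fun _ => 0)); auto.
      intros; apply continuous_const.
    - apply ex_RInt_const.
    - intros x Hx. rewrite HY, HQ. unfold excess.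
      replace (T x + t * P x - T x) with (t * P x) by ring.
      replace (P x + t * (-2 * eps * sin (2 * T x)) - P x - w x * (t * P x)) with 0
        by (unfold w; field; apply Rgt_not_eq, Hpos).
      assert (HB : cos_rem (2 * T x) (2 * (t * P x)) <= 8 * (t ^ 3 * M ^ 3)).
      { pose proof (cos_rem_bound (2 * T x) (2 * (t * P x))) as B.
        apply Rabs_le_between in B. apply Rle_trans with (1 := proj2 B).
        replace (8 * (t ^ 3 * M ^ 3)) with ((2 * (t * M)) ^ 3) by ring.
        apply pow_incr. split; [apply Rabs_pos|].
        rewrite !Rabs_mult, (Rabs_pos_eq 2), (Rabs_pos_eq t) by lra.
        assert (Rabs (P x) <= M)
          by (apply (equilibrium_velocity_bound eps L U0 T P); auto; unfold seg; lra).
        apply Rmult_le_compat_l; [lra|]. apply Rmult_le_compat_l; lra. }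
      apply (Rmult_le_compat_l eps) in HB; lra. }
  assert (Hb : w L * (Y L - T L) ^ 2 / 2 - w 0 * (Y 0 - T 0) ^ 2 / 2 =
               - 2 * eps * t ^ 2 * (U0 * sin (2 * T L))).
  { unfold w. rewrite !HY, HPL, HP0, Hsym, sin_2_PI_minus. field. lra. }
  rewrite Hb.
  assert (Ht' : t * (4 * M ^ 3 * L) < U0 * sin (2 * T L)).
  { destruct Ht as [_ Ht].
    apply (Rmult_lt_compat_r (4 * M ^ 3 * L)) in Ht; [|apply Rmult_lt_0_compat; lra].
    replace (U0 * sin (2 * T L) / (4 * M ^ 3 * L) * (4 * M ^ 3 * L))
      with (U0 * sin (2 * T L)) in Ht by (field; lra).
    exact Ht. }
  assert (0 < 2 * eps * t ^ 2 * (U0 * sin (2 * T L) - t * (4 * M ^ 3 * L))).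
  { apply Rmult_lt_0_compat; [|lra]. apply Rmult_lt_0_compat; [lra|].
    apply pow_lt; lra. }
  lra.
- intros x Hx. replace (0 - w x ^ 2) with (- w x ^ 2) by ring.
  apply (is_derive_log_velocity eps L U0 T P x Heq Hx), Rgt_not_eq, Hpos.
Qed.

(** * The equilibria of the ladder *)

Lemma helical_geometry (eps L U0 : R) (theta : R -> R) :
  0 < eps -> 0 < L -> is_left_handed_helical eps L U0 theta ->
  PI / 2 < theta L ->
  theta 0 = PI - theta L /\ theta (L / 2) = PI / 2 /\
  (forall x, seg 0 L x -> 0 < Derive_on 0 L theta x).
Proof.
intros Heps HL [Heq [Hsym Hne]] HTL.
assert (H0 : theta 0 = PI - theta L).
{ specialize (Hsym L ltac:(unfold seg; lra)).
  rewrite Rminus_diag in Hsym. lra. }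
assert (Hmid : theta (L / 2) = PI / 2).
{ specialize (Hsym (L / 2) ltac:(unfold seg; lra)).
  replace (L - L / 2) with (L / 2) in Hsym by field. lra. }
split; [exact H0|split; [exact Hmid|]].
intros x Hx. rewrite <- (clamp_id 0 L x Hx).
apply (helical_velocity_pos eps L U0 (fun y => theta (clamp 0 L y))
         (fun y => Derive_on 0 L theta (clamp 0 L y))); auto.
- now apply equilibrium_path_clamp.
- rewrite clamp_id by (unfold seg; lra). exact Hmid.
- intros y Hy. rewrite clamp_id by (unfold seg; lra). now apply Hne.
- rewrite !clamp_id by (unfold seg; lra). lra.
Qed.

Theorem mainTheorem5 :
  forall (eps L U0 : R) (theta : R -> R),
    0 < eps ->
    0 < L ->
    is_left_handed_helical eps L U0 theta ->
    (PI / 2 < theta L < PI -> stable eps L U0 theta) /\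
    (PI < theta L < 3 * PI / 2 -> ~ stable eps L U0 theta).
Proof.
intros eps L U0 theta Heps HL Hhel.
assert (Heq := proj1 Hhel). assert (HC1 := equilibrium_C1_on _ _ _ _ Heq).
assert (Hpath := equilibrium_path_clamp _ _ _ _ HL Heq).
assert (HidL : clamp 0 L L = L) by (apply clamp_id; unfold seg; lra).
assert (Hid0 : clamp 0 L 0 = 0) by (apply clamp_id; unfold seg; lra).
assert (Hidh : clamp 0 L (L / 2) = L / 2) by (apply clamp_id; unfold seg; lra).
assert (Hin : forall x, seg 0 L (clamp 0 L x)) by (intros; apply clamp_in; lra).
pose proof PI_RGT_0.
split.
- intros HTL.
  destruct (helical_geometry eps L U0 theta Heps HL Hhel ltac:(lra))
    as [H0 [Hmid Hpos]].
  destruct (stable_path eps L U0 _ _ Heps HL Hpath) as [d [Hd Hmin]].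
  + intros x. now apply Hpos.
  + now rewrite Hidh.
  + now rewrite Hid0, HidL.
  + now rewrite HidL.
  + exists (mkposreal d Hd). intros eta Heta Hnorm.
    rewrite !energy_clamp by exact HL.
    apply Hmin; [now apply C1_path_clamp|].
    intros x Hx. rewrite (clamp_id 0 L x Hx).
    apply (C1_norm_lt_ub 0 L d (fun y => eta y - theta y));
      [lra|exact Hx|exact Hnorm].
- intros HTL [d Hmin].
  destruct (helical_geometry eps L U0 theta Heps HL Hhel ltac:(lra))
    as [H0 [Hmid Hpos]].
  destruct (unstable_path eps L U0 _ _ Heps HL Hpath) as [t0 [Ht0 Hlow]].
  + intros x. now apply Hpos.
  + now rewrite Hid0, HidL.
  + rewrite HidL. replace (2 * theta L) with (2 * (theta L - PI) + 2 * PI) by ring.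
    rewrite sin_plus, sin_2PI, cos_2PI, Rmult_0_r, Rmult_1_r, Rplus_0_r.
    apply sin_gt_0; lra.
  + set (M := U0 ^ 2 + 4 * eps + 1) in *.
    set (N := M + 2 * eps).
    assert (HN : 0 < N) by (unfold N, M; nra).
    pose proof (cond_pos d) as Hd.
    assert (HdN : 0 < d / (2 * N)) by (apply Rdiv_lt_0_compat; lra).
    set (t := Rmin (t0 / 2) (d / (2 * N))).
    assert (Ht : 0 < t) by (apply Rmin_glb_lt; lra).
    assert (Htt : t < t0) by (pose proof (Rmin_l (t0 / 2) (d / (2 * N))); unfold t; lra).
    assert (HtN : t * N < d).
    { apply Rle_lt_trans with (d / (2 * N) * N).
      - apply Rmult_le_compat_r; [lra|apply Rmin_r].
      - replace (d / (2 * N) * N) with (d / 2) by (field; lra). lra. }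
    set (p := Derive_on 0 L theta) in *.
    set (eta := fun x => theta x + t * p x).
    assert (Heta : forall x, seg 0 L x ->
      is_derive_on 0 L eta x (p x + t * (- 2 * eps * sin (2 * theta x)))).
    { intros x Hx. apply is_derive_on_plus.
      - apply ex_derive_on_Derive_on; [exact HL|exact Hx|]. now apply HC1.
      - apply is_derive_on_scal. now apply (equilibrium_Derive_on eps L U0). }
    assert (HDeta : forall x, seg 0 L x ->
      Derive_on 0 L eta x = p x + t * (- 2 * eps * sin (2 * theta x))).
    { intros x Hx. apply Derive_on_unique; auto. }
    assert (Hex : forall x, seg 0 L x -> ex_derive_on 0 L eta x).
    { intros x Hx. eexists. now apply Heta. }
    assert (HetaC1 : C1_on 0 L eta).
    { split; [exact Hex|].
      apply (continuous_on_ext _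
        (fun x => p x + t * (- 2 * eps * sin (2 * theta x)))).
      - intros x Hx. symmetry. now apply HDeta.
      - apply continuous_on_clamp. intros x.
        destruct Hpath as [[HTc [HPc _]] _]. solve_continuous. }
    apply (Rlt_not_le (energy eps L U0 theta) (energy eps L U0 eta)).
    * rewrite !energy_clamp by exact HL.
      apply (Hlow t); [lra|now apply C1_path_clamp|reflexivity|].
      intros x. now apply HDeta.
    * apply Hmin; [exact HetaC1|].
      apply Rbar_le_lt_trans with (t * M + t * (2 * eps)); [|simpl; unfold N in HtN; lra].
      assert (Hdiff : forall x, eta x - theta x = t * p x) by (intros; unfold eta; ring).
      apply C1_norm_le; intros x Hx.
      -- rewrite Hdiff, Rabs_mult, (Rabs_pos_eq t) by lra.
         apply Rmult_le_compat_l; [lra|].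
         pose proof (equilibrium_velocity_bound eps L U0 _ _ x Heps Hpath Hx) as B.
         simpl in B. rewrite (clamp_id 0 L x Hx) in B. exact B.
      -- rewrite Derive_on_minus by (auto; now apply HC1).
         rewrite HDeta by exact Hx. fold p.
         replace (p x + t * (- 2 * eps * sin (2 * theta x)) - p x)
           with (t * (2 * eps * - sin (2 * theta x))) by ring.
         rewrite !Rabs_mult, (Rabs_pos_eq t), (Rabs_pos_eq 2), (Rabs_pos_eq eps),
           Rabs_Ropp by lra.
         assert (Rabs (sin (2 * theta x)) <= 1)
           by (apply Rabs_le; destruct (SIN_bound (2 * theta x)); lra).
         apply Rmult_le_compat_l; [lra|].
         rewrite <- (Rmult_1_r (2 * eps)) at 2. apply Rmult_le_compat_l; lra.
Qed.
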